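(* Let $X$ be a locally convex topological vector space and let $f\colon X \to \mathbb{R}$ be lower semicontinuous, strictly convex and bounded on compact sets. Then for every compact convex $K \subset X$, the set of points of $K$ which are both exposed points of $K$ and continuity points of $f|_K$ is dense in $\mathrm{ext}(K)$.
   Context: All vector spaces are real and locally convex spaces are Hausdorff. $\mathrm{ext}(K)$ is the set of extreme points of $K$. $f$ is strictly convex if $f(\lambda x+(1-\lambda)y)<\lambda f(x)+(1-\lambda)f(y)$ for all $x\neq y$ and $\lambda\in(0,1)$. A point $x\in K$ is an exposed point of $K$ if there is a continuous affine function $w\colon K\to\mathbb{R}$ such that $\{x\}=\{z\in K: w(z)=\sup_K w\}$ (the function $w$ need not be the restriction of an element of the dual of $X$). *)

(* Defs.v *)
From HB Require Import structures.
From mathcomp Require Import all_boot all_order all_algebra.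
From mathcomp Require Import all_classical all_reals all_analysis.

Set Implicit Arguments.
Unset Strict Implicit.
Unset Printing Implicit Defensive.

Import Order.TTheory GRing.Theory Num.Theory.
Import numFieldNormedType.Exports.

Local Open Scope classical_set_scope.
Local Open Scope ring_scope.

Definition strictly_convex (R : realType) (X : lmodType R) (f : X -> R) : Prop :=
  forall (x y : X) (t : R), x <> y -> 0 < t -> t < 1 ->
    f (t *: x + (1 - t) *: y) < t * f x + (1 - t) * f y.

Definition bounded_on_compacts (R : realType) (X : topologicalType)
    (f : X -> R) : Prop :=
  forall C : set X, compact C -> [bounded (f x : R^o) | x in C].

Definition extreme_points (R : realType) (X : lmodType R) (K : set X) : set X :=
  [set x | K x /\ forall (y z : X) (t : R), K y -> K z -> 0 < t -> t < 1 ->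
    x = t *: y + (1 - t) *: z -> y = x /\ z = x].

(* A function K -> R is represented by a total function w : X -> R of which
   only the values on K matter; w need not be affine or continuous off K. *)
Definition affine_on (R : realType) (X : lmodType R) (K : set X)
    (w : X -> R) : Prop :=
  forall (x y : X) (t : R), K x -> K y -> 0 <= t -> t <= 1 ->
    w (t *: x + (1 - t) *: y) = t * w x + (1 - t) * w y.

(* The supremum is taken in \bar R because the real-valued sup takes a default
   value when w is unbounded on K. *)
Definition exposed_points (R : realType) (X : tvsType R) (K : set X) : set X :=
  [set x | exists w : X -> R,
    [/\ {within K, continuous w}, affine_on K w &
        [set x] = [set z | K z /\
                     (w z)%:E = ereal_sup [set (w y)%:E | y in K]]]].

Definition continuity_points (R : realType) (X : topologicalType) (K : set X)
    (f : X -> R) : set X :=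
  [set x | K x /\ f @ within K (nbhs x) --> f x].

(* [dense] for [subspace A] is not usable here: the points outside A are
   isolated in that space. *)
Definition dense_in (X : topologicalType) (S A : set X) : Prop :=
  S `<=` A /\ A `<=` closure S.

(* Main.v *)
Require Import Defs.
From HB Require Import structures.
From mathcomp Require Import all_boot all_order all_algebra.
From mathcomp Require Import all_classical all_reals all_analysis.
From mathcomp Require Import ring lra.

Set Implicit Arguments.
Unset Strict Implicit.
Unset Printing Implicit Defensive.

Import Order.TTheory GRing.Theory Num.Theory.
Import numFieldNormedType.Exports.

Local Open Scope classical_set_scope.
Local Open Scope ring_scope.

(* A slice [{g > a}] of [K], with [g] continuous affine, is refined by adding to
   [g] a small multiple [h u] of a continuous affine minorant [u] of [f] that is
   nearly exact at a near-maximum of [g + h f] on [K]: on the slice of [g + h u]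
   near its maximum, [f - u] is small. The norms of these minorants on [K] are
   bounded because [f] is bounded on the compact set [2 K - K], so the multiples
   can be chosen to make the sequence of functions converge uniformly on [K], and
   the limit [w] attains its maximum inside all the slices. On these, [f] is
   arbitrarily close to continuous affine functions, so [f] is continuous on [K]
   at the maximizers of [w], and by strict convexity there is only one of them.
   The first slice is taken inside a given neighbourhood of an extreme point. *)

(** * Sublinear functionals and the Hahn-Banach theorem *)

Definition sublinear (R : realType) (X : lmodType R) (q : X -> R) : Prop :=
  (forall x y, q (x + y) <= q x + q y) /\
  (forall t x, 0 < t -> q (t *: x) <= t * q x).

Lemma sublinear0 (R : realType) (X : lmodType R) (q : X -> R) :
  sublinear q -> q 0 = 0.
Proof.
move=> [_ qZ]; have := qZ 2 0; have := qZ 2^-1 0.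
by rewrite !scaler0 invr_gt0 ltr0n => /(_ isT) h1 /(_ isT) h2; lra.
Qed.

Lemma sublinearN (R : realType) (X : lmodType R) (q : X -> R) x :
  sublinear q -> - q (- x) <= q x.
Proof. by move=> sq; have := sq.1 x (- x); rewrite subrr sublinear0//; lra. Qed.

Lemma sublinearZ (R : realType) (X : lmodType R) (q : X -> R) t x :
  sublinear q -> 0 <= t -> q (t *: x) = t * q x.
Proof.
move=> sq; rewrite le_eqVlt => /predU1P[<-|t0].
  by rewrite scale0r mul0r sublinear0.
apply/eqP; rewrite eq_le sq.2//= -ler_pdivlMl//.
by have := sq.2 t^-1 (t *: x); rewrite invr_gt0 scalerA mulVf ?gt_eqF// scale1r; exact.
Qed.

(** The hypotheses on [P] make the pairs [(z, r)] with [P z r] a convex cone, and the infimum is its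
    lower boundary. All sublinear functionals constructed below arise in this way. *)
Lemma sublinear_inf (R : realType) (X : lmodType R) (P : X -> set R) :
  (forall z, P z !=set0) -> (forall z, has_lbound (P z)) ->
  (forall z w r s, P z r -> P w s -> P (z + w) (r + s)) ->
  (forall t z r, 0 < t -> P z r -> P (t *: z) (t * r)) ->
  sublinear (fun z => inf (P z)).
Proof.
move=> P0 Plb PD PZ.
have infle z r : P z r -> inf (P z) <= r by move=> Pr; apply: ge_inf.
split=> [x y|t x t0].
  rewrite -lerBlDr; apply: lb_le_inf => // r Pr.
  rewrite lerBlDr -lerBlDl; apply: lb_le_inf => // s Ps.
  by rewrite lerBlDl; apply/infle/PD.
rewrite mulrC -ler_pdivrMr//; apply: lb_le_inf => // r Pr.
by rewrite ler_pdivrMr// mulrC; apply/infle/PZ.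
Qed.

(* For fixed [y], the infimum over [t >= 0] of [q (z + t y) - t q y] is
   sublinear in [z] and below [q], hence equal to [q]; at [z = - y] this gives
   [q (- y) <= - q y]. *)
Lemma minimal_sublinear_scalar (R : realType) (X : lmodType R) (q : X -> R) :
  sublinear q ->
  (forall r, sublinear r -> (forall x, r x <= q x) -> r = q) ->
  scalar q.
Proof.
move=> sq qmin.
have [qD qZ] := sq.
have qN y : q (- y) = - q y.
  pose P z := [set r | exists2 t, 0 <= t & q (z + t *: y) - t * q y <= r].
  have Plb z : lbound (P z) (- q (- z)).
    move=> r [t t0]; have := qD (z + t *: y) (- z).
    by rewrite addrAC subrr add0r sublinearZ//; lra.
  have Pq z : P z (q z) by exists 0 => //; rewrite scale0r mul0r addr0 subr0.
  have sP : sublinear (fun z => inf (P z)).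
    apply: sublinear_inf => [z|z|z w r s [t t0 tr] [u u0 us]|t z r t0 [u u0 us]].
    - by exists (q z).
    - by exists (- q (- z)); exact: Plb.
    - exists (t + u); first exact: addr_ge0.
      have := qD (z + t *: y) (w + u *: y).
      by rewrite addrACA -scalerDl; lra.
    - exists (t * u); first by rewrite mulr_ge0// ltW.
      rewrite -scalerA -scalerDr.
      have := qZ _ (z + u *: y) t0; have : t * (q (z + u *: y) - u * q y) <= t * r.
        by rewrite ler_pM2l.
      by lra.
  have Pe : (fun z => inf (P z)) = q.
    apply: qmin => // x; apply: ge_inf (Pq x).
    by exists (- q (- x)); exact: Plb.
  apply/eqP; rewrite eq_le -{1}Pe; apply/andP; split.
    apply: ge_inf; first by exists (- q (- - y)); exact: Plb.
    by exists 1; rewrite // scale1r addNr mul1r sublinear0// sub0r.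
  by have := sublinearN y sq; lra.
move=> a u v.
(* Once [q] is odd, superadditivity is subadditivity applied to [x = (x + y) - y]. *)
have qadd x y : q (x + y) = q x + q y.
  by apply/eqP; rewrite eq_le qD/=; have := qD (x + y) (- y); rewrite addrK qN; lra.
rewrite qadd; congr (_ + _).
have [a0|a0] := leP 0 a; first by rewrite sublinearZ.
by rewrite -[a]opprK scaleNr qN sublinearZ ?mulNr// oppr_ge0 ltW.
Qed.

Lemma hahn_banach (R : realType) (X : lmodType R) (S : X -> R) :
  sublinear S -> exists2 l : X -> R, scalar l & forall x, l x <= S x.
Proof.
move=> sS.
pose below (q : X -> R) := sublinear q /\ forall x, q x <= S x.
pose T := {q : X -> R | below q}.
(* The order is reversed, so that a maximal element for Zorn's lemma is a minimal sublinear
   functional, which is linear. *)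
pose le (q r : T) := `[< forall x, sval r x <= sval q x >].
have [||||[q [sq qS]] qmax] := @Zorn T le.
- by move=> q; apply/asboolP.
- move=> q r s /asboolP qr /asboolP rs; apply/asboolP => x.
  exact: le_trans (rs x) (qr x).
- move=> [q qP] [r rP] /asboolP qr /asboolP rq; apply: eq_exist.
  by apply/funext => x; apply/eqP; rewrite eq_le qr rq.
- move=> A totA.
  have [[q0 Aq0]|/nonemptyPn ->] := pselect (A !=set0); last first.
    by exists (exist below S (conj sS (fun=> lexx _))).
  pose P z := [set r | exists2 q, A q & sval q z <= r].
  (* Every [q] in the chain satisfies [q z >= - q (- z) >= - S (- z)], so the infimum over the chain
     is finite. *)
  have Plb z : lbound (P z) (- S (- z)).
    move=> r [[q [sq qS]] _ /=]; have := sublinearN z sq.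
    by have := qS (- z); lra.
  have sP : sublinear (fun z => inf (P z)).
    apply: sublinear_inf => [z|z|z w r s [q Aq qr] [p Ap ps]|t z r t0 [q Aq qr]].
    - by exists (sval q0 z); exists q0.
    - by exists (- S (- z)); exact: Plb.
    - have [sq _] := svalP q; have [sp _] := svalP p.
      have [/asboolP qp|/asboolP pq] := totA _ _ Aq Ap.
      + exists p => //; apply: le_trans (sp.1 _ _) _.
        by apply: lerD => //; apply: le_trans qr.
      + exists q => //; apply: le_trans (sq.1 _ _) _.
        by apply: lerD => //; apply: le_trans ps.
    - exists q => //; have [sq _] := svalP q.
      by apply: le_trans (sq.2 _ _ t0) _; rewrite ler_pM2l.
  have Ple q z : A q -> inf (P z) <= sval q z.
    by move=> Aq; apply: ge_inf; [exists (- S (- z)); exact: Plb | exists q].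
  have PS z : inf (P z) <= S z by apply: le_trans (Ple q0 _ _) _; last exact: (svalP q0).2.
  exists (exist below _ (conj sP PS)) => q Aq; apply/asboolP => x /=.
  exact: Ple.
exists q => //; apply: minimal_sublinear_scalar => // r sr rq.
have rS x : r x <= S x by exact: le_trans (rq x) (qS x).
have := qmax (exist below r (conj sr rS)).
by move=> /(_ (asboolT rq)) [].
Qed.

(** * Convex sets and continuity of linear functionals *)

Lemma convex_setP (R : realType) (X : lmodType R) (A : set X) :
  convex_set A <-> forall x y t, A x -> A y -> 0 <= t -> t <= 1 ->
    A (t *: x + (1 - t) *: y).
Proof.
split=> [cA x y t Ax Ay t0 t1|cA x y t /set_mem Ax /set_mem Ay].
  by have /set_mem := cA x y (Itv01 t0 t1) (mem_set Ax) (mem_set Ay).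
by apply/mem_set; apply: cA.
Qed.

Section tvs.
Variables (R : realType) (X : tvsType R).

Lemma tvs_cvgD {T : Type} {F : set_system T} {FF : Filter F}
    (g h : T -> X) a b :
  g @ F --> a -> h @ F --> b -> (fun x => g x + h x) @ F --> a + b.
Proof.
by move=> ga hb; apply: continuous2_cvg => //; exact: (@add_continuous _ (a, b)).
Qed.

Lemma tvs_cvgZ {T : Type} {F : set_system T} {FF : Filter F}
    (k : T -> R^o) (g : T -> X) (r : R^o) (a : X) :
  k @ F --> r -> g @ F --> a -> (fun x => k x *: g x) @ F --> r *: a.
Proof.
move=> kr ga; apply: continuous2_cvg => //.
exact: (@scale_continuous _ _ (r, a)).
Qed.

Lemma convex_nbhs (x : X) (U : set X) : nbhs x U ->
  exists V : set X, [/\ nbhs x V, V `<=` U & convex_set V].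
Proof.
have [B Bcvx [Bopen /(_ x)Bx]] := @locally_convex R X.
move=> /Bx[V [BV Vx] VU]; exists V; split=> //.
  by apply: open_nbhs_nbhs; split => //; exact: Bopen.
by apply/Bcvx/mem_set.
Qed.

Lemma scalar_continuous (l : X -> R) (N : R) :
  scalar l -> (\forall v \near 0, l v <= N) -> continuous l.
Proof.
move=> ls lN.
have lZB k x y : l (k *: (y - x)) = k * (l y - l x).
  have l0 : l 0 = 0 by have := ls (-1) 0 0; rewrite scaler0 addr0; lra.
  rewrite -[k *: _]addr0 ls l0 addr0; congr (_ * _).
  by rewrite -scaleN1r addrC ls; ring.
move=> x; apply/cvgrPdist_le => e e0.
(* With [N <= k * e], the bound by [N] at both [k *: (y - x)] and [(- k) *: (y - x)] bounds the
   increment of [l] by [e] on both sides. *)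
pose k := (`|N| + 1) / e.
have k0 : 0 < k by rewrite divr_gt0// ltr_wpDl.
have cvk (c : R) : (fun y => c *: (y - x)) @ x --> (0 : X).
  rewrite -(scaler0 X c) -(subrr x); apply: tvs_cvgZ; first exact: cvg_cst.
  by apply: tvs_cvgD; [exact: cvg_id|exact: cvg_cst].
near=> y.
have : l (k *: (y - x)) <= N by near: y; exact: (cvk k _ lN).
have : l ((- k) *: (y - x)) <= N by near: y; exact: (cvk (- k) _ lN).
rewrite !lZB => h1 h2; have Nk : N <= k * e.
  by rewrite /k divfK ?gt_eqF//; have := ler_norm N; lra.
rewrite ler_norml; apply/andP; split; rewrite -(ler_pM2l k0); lra.
Unshelve. all: by end_near. Qed.

End tvs.

(** * Convex cones and continuous affine minorants *)

Section cone.
Variables (R : realType) (X : lmodType R) (C : set X) (phi : X -> R).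
Hypothesis Ccvx : forall x y t, C x -> C y -> 0 <= t -> t <= 1 ->
  C (t *: x + (1 - t) *: y).
Hypothesis phicvx : forall x y t, C x -> C y -> 0 <= t -> t <= 1 ->
  phi (t *: x + (1 - t) *: y) <= t * phi x + (1 - t) * phi y.

(** The cone generated by the epigraph of [phi] is closed under addition: [z] is the weighted mean
    of [x] and [y]. With [phi] zero this concerns only the set [C]. *)
Lemma cone_convex s t x y : 0 <= s -> 0 <= t -> C x -> C y ->
  exists z, [/\ C z, s *: x + t *: y = (s + t) *: z &
    (s + t) * phi z <= s * phi x + t * phi y].
Proof.
move=> s0 t0 Cx Cy.
have [/eqP|st0] := eqVneq (s + t) 0.
  rewrite paddr_eq0// => /andP[/eqP-> /eqP->].
  by exists x; rewrite addr0 !scale0r !mul0r !addr0.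
have st : 0 < s + t by rewrite lt_neqAle eq_sym st0 addr_ge0.
have e1 : 1 - s / (s + t) = t / (s + t) by field.
have r0 : 0 <= s / (s + t) by rewrite divr_ge0// ltW.
have r1 : s / (s + t) <= 1 by rewrite ler_pdivrMr// mul1r lerDl.
exists (s / (s + t) *: x + (1 - s / (s + t)) *: y); split.
- exact: Ccvx.
- by rewrite scalerDr !scalerA e1 ![(s + t) * _]mulrC !divfK.
- have := phicvx Cx Cy r0 r1; rewrite -(ler_pM2l st) => /le_trans; apply.
  by rewrite le_eqVlt; apply/orP; left; apply/eqP; field.
Qed.

End cone.

(** All real [t] are allowed, so that [u] can be expanded at the reflected points
    [2 *: x0 + (1 - 2) *: y]. *)
Definition affine (R : realType) (X : lmodType R) (u : X -> R) : Prop :=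
  forall x y t, u (t *: x + (1 - t) *: y) = t * u x + (1 - t) * u y.

(* The functional is obtained from Hahn-Banach applied to the sublinear
   functional whose epigraph is the cone generated by [V * [N, +oo[] and by the
   pairs [(x0 - y, phi y - b)], where [V] is a convex neighbourhood of [0] such
   that [b <= phi] on [C] near [x0]. *)
Lemma affine_minorant (R : realType) (X : tvsType R) (C : set X) (phi : X -> R)
    (x0 : X) (b m : R) :
  C !=set0 -> convex_set C ->
  (forall x y t, C x -> C y -> 0 <= t -> t <= 1 ->
    phi (t *: x + (1 - t) *: y) <= t * phi x + (1 - t) * phi y) ->
  (forall y, C y -> m <= phi y) ->
  (\forall y \near x0, C y -> b <= phi y) ->
  exists u : X -> R, [/\ affine u, continuous u, u x0 = b &
    forall y, C y -> u y <= phi y].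
Proof.
move=> [c Cc] /convex_setP Ccvx phicvx phim phib.
have cvx0 : (fun v => x0 + v) @ (0 : X) --> x0.
  rewrite -[X in _ --> X](addr0 x0).
  by apply: tvs_cvgD; [exact: cvg_cst|exact: cvg_id].
have [V [V0 Vphi /convex_setP Vcvx]] := convex_nbhs (cvx0 _ phib).
have V00 : V 0 by exact: nbhs_singleton.
pose N := `|b - m|.
have N0 : 0 <= N by exact: normr_ge0.
have phiN y : C y -> - N <= phi y - b.
  by move=> /phim; have := ler_norm (b - m); rewrite -/N; lra.
pose P z := [set r | exists s t v y, [/\ 0 <= s, 0 <= t, V v, C y &
  z = s *: v - t *: (y - x0) /\ N * s + t * (phi y - b) <= r]].
have Vjoin s t v w : 0 <= s -> 0 <= t -> V v -> V w ->
    exists2 a, V a & s *: v + t *: w = (s + t) *: a.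
  move=> s0 t0 Vv Vw.
  have [|a [? ? _]] := cone_convex (phi := fun=> 0) Vcvx _ s0 t0 Vv Vw.
    by move=> *; rewrite !mulr0 addr0.
  by exists a.
have Vabs z : exists s v, [/\ 0 < s, V v & z = s *: v].
  have cz : (fun t : R^o => t *: z) @ (0 : R^o) --> (0 : X).
    rewrite -[X in _ --> X](scale0r z).
    by apply: tvs_cvgZ; [exact: cvg_id|exact: cvg_cst].
  have /nbhs_ballP[e /= e0 eV] := cz _ V0.
  exists (e / 2)^-1, (e / 2 *: z); split; first by rewrite invr_gt0 divr_gt0.
    apply: (eV (e / 2)); rewrite /ball/= sub0r normrN gtr0_norm ?divr_gt0//.
    by rewrite ltr_pdivrMr// ltr_pMr// ltr1n.
  by rewrite scalerA mulVf ?scale1r// gt_eqF// divr_gt0.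
(* Writing [- z] as [s' *: v'] gives [t *: (y - x0) = (s + s') *: a] with [a] in [V]. If
   [t < s + s'], the bound [- N <= phi y - b] suffices; otherwise [y - x0] is in [V] by convexity,
   and [b <= phi y]. *)
have Plb z : has_lbound (P z).
  have [s' [v' [s'0 Vv' zE]]] := Vabs (- z).
  exists (- (N * s')) => r [s [t [v [y [s0 t0 Vv Cy [zE' hr]]]]]]; apply: le_trans hr.
  have [a Va aE] := Vjoin _ _ _ _ s0 (ltW s'0) Vv Vv'.
  have tE : t *: (y - x0) = (s + s') *: a.
    by rewrite -aE -zE {1}zE' opprB addrCA subrr addr0.
  have [st|st] := leP (s + s') t; last first.
    have := phiN _ Cy; rewrite -subr_ge0 => h.
    have := mulr_ge0 t0 h; have : 0 <= N * (s + s' - t) by rewrite mulr_ge0//; lra.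
    by lra.
  suff : 0 <= t * (phi y - b).
    have := mulr_ge0 N0 s0; have := mulr_ge0 N0 (ltW s'0); lra.
  rewrite mulr_ge0// subr_ge0.
  have t_gt0 : 0 < t by apply: lt_le_trans st; apply: ltr_wpDl.
  have -> : y = x0 + (y - x0) by rewrite addrC subrK.
  apply: Vphi => /=; last by rewrite addrC subrK.
  have -> : y - x0 = ((s + s') / t) *: a + (1 - (s + s') / t) *: 0.
    rewrite scaler0 addr0 mulrC -scalerA -tE scalerA mulVf ?scale1r//.
    by rewrite gt_eqF.
  apply: Vcvx => //; first by rewrite divr_ge0// addr_ge0// ltW.
  by rewrite ler_pdivrMr// mul1r.
have sP : sublinear (fun z => inf (P z)).
  apply: sublinear_inf => // [z|z w r r'|k z r k0].
  - have [s [v [s0 Vv ->]]] := Vabs z.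
    exists (N * s), s, 0, v, c; split => //; first exact: ltW.
    split; first by rewrite scale0r subr0.
    by rewrite mul0r addr0.
  - move=> [s [t [v [y [s0 t0 Vv Cy [-> hr]]]]]].
    move=> [s' [t' [v' [y' [s'0 t'0 Vv' Cy' [-> hr']]]]]].
    have [a Va aE] := Vjoin _ _ _ _ s0 s'0 Vv Vv'.
    have [d [Cd dE dphi]] := cone_convex Ccvx phicvx t0 t'0 Cy Cy'.
    exists (s + s'), (t + t'), a, d; split => //; try exact: addr_ge0.
    split; last by lra.
    have -> : (t + t') *: (d - x0) = t *: (y - x0) + t' *: (y' - x0).
      by rewrite !scalerBr -dE addrACA -opprD -scalerDl.
    by rewrite -aE opprD addrACA.
  - move=> [s [t [v [y [s0 t0 Vv Cy [-> hr]]]]]].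
    exists (k * s), (k * t), v, y; split => //; try by rewrite mulr_ge0// ltW.
    split; first by rewrite scalerBr !scalerA.
    have : k * (N * s + t * (phi y - b)) <= k * r by rewrite ler_pM2l.
    by lra.
have [l ls lP] := hahn_banach sP.
have lPr z r : P z r -> l z <= r.
  by move=> Pr; apply: le_trans (lP z) _; apply: ge_inf.
(* The generators [(v, N)] bound [l] on [V], whence continuity; the generators [(x0 - y, phi y - b)]
   will give the inequality on [C]. *)
have lc : continuous l.
  apply: (@scalar_continuous _ _ _ N) => //.
  apply: filterS V0 => v Vv; apply: lPr.
  exists 1, 0, v, c; split => //; split; first by rewrite scale1r scale0r subr0.
  by rewrite mul0r addr0 mulr1.
have l0 : l 0 = 0 by have := ls (-1) 0 0; rewrite scaler0 addr0; lra.
have lB x y : l (x - y) = l x - l y.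
  by rewrite -scaleN1r addrC ls; ring.
exists (fun z => b - l (z - x0)); split.
- move=> x y t; rewrite !lB.
  have -> : l (t *: x + (1 - t) *: y) = t * l x + (1 - t) * l y.
    by rewrite ls -[(1 - t) *: y]addr0 ls l0 addr0.
  by ring.
- move=> z; apply: cvgB; first exact: cvg_cst.
  apply: (@cvg_comp _ _ _ (fun z => z - x0) l _ (nbhs (z - x0))); last exact: lc.
  by apply: tvs_cvgD; [exact: cvg_id|exact: cvg_cst].
- by rewrite subrr l0 subr0.
- move=> y Cy; suff : l (x0 - y) <= phi y - b by rewrite !lB; lra.
  apply: lPr; exists 0, 1, 0, y; split => //; split.
    by rewrite scale0r scale1r sub0r opprB.
  by rewrite mulr0 add0r mul1r.
Qed.

(** * Separation of a point from a compact convex set, and slices around extreme points *)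

Section extreme.
Variables (R : realType) (X : tvsType R).
Hypothesis hX : hausdorff_space X.
Implicit Types (A B D K U : set X) (x y : X).

Lemma affine_cst (b : R) : affine (fun _ : X => b).
Proof. by move=> x y t; ring. Qed.

Definition convex_join A B : set X :=
  [set z | exists t a b,
    [/\ 0 <= t, t <= 1, A a, B b & z = t *: a + (1 - t) *: b]].

(** The join is a continuous image of the product of [[0, 1]], [A] and [B], hence compact. It is
    convex because the terms from [A] and those from [B] in a combination can be grouped
    separately. *)
Lemma convex_joinP A B : convex_set A -> convex_set B -> compact A -> compact B ->
  A !=set0 -> B !=set0 ->
  [/\ compact (convex_join A B), convex_set (convex_join A B),
    A `<=` convex_join A B & B `<=` convex_join A B].
Proof.
move=> /convex_setP Acvx /convex_setP Bcvx Ac Bc [a0 Aa0] [b0 Bb0]; split.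
- pose h (p : R^o * (X * X)) := p.1 *: p.2.1 + (1 - p.1) *: p.2.2.
  rewrite [X in compact X](_ : _ = h @` (`[0, 1] `*` (A `*` B))); last first.
    apply/seteqP; split=> [z [t [a [b [t0 t1 Aa Bb ->]]]]|z].
      by exists (t, (a, b)); rewrite //= in_itv/= t0 t1.
    move=> [[t [a b]] [/= tI [Aa Bb]] <-]; move: tI; rewrite in_itv/= => /andP[t0 t1].
    by exists t, a, b.
  apply: continuous_compact.
    apply: continuous_subspaceT => -[t [a b]].
    have c1 : p.1 @[p --> (t, (a, b))] --> (t : R^o) by exact: cvg_fst.
    have c2 : p.2 @[p --> ((t : R^o), (a, b))] --> (a, b) by exact: cvg_snd.
    apply: tvs_cvgD; apply: tvs_cvgZ => //.
    + by apply: cvg_comp c2 _; exact: cvg_fst.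
    + by apply: cvgB => //; exact: cvg_cst.
    + by apply: cvg_comp c2 _; exact: cvg_snd.
  apply: compact_setX; last exact: compact_setX.
  exact: segment_compact.
- apply/convex_setP => z w s.
  move=> [t [a [b [t0 t1 Aa Bb ->]]]] [t' [a' [b' [t'0 t'1 Aa' Bb' ->]]]] s0 s1.
  have u0 : 0 <= 1 - s by rewrite subr_ge0.
  have v0 : 0 <= 1 - t by rewrite subr_ge0.
  have v'0 : 0 <= 1 - t' by rewrite subr_ge0.
  have cst (C : set X) y y1 r : C y -> C y1 -> 0 <= r -> r <= 1 ->
      (fun=> 0 : R) (r *: y + (1 - r) *: y1) <= r * 0 + (1 - r) * 0.
    by rewrite !mulr0 addr0.
  have [a2 [Aa2 aE _]] := cone_convex Acvx (@cst A)
    (mulr_ge0 s0 t0) (mulr_ge0 u0 t'0) Aa Aa'.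
  have [b2 [Bb2 bE _]] := cone_convex Bcvx (@cst B)
    (mulr_ge0 s0 v0) (mulr_ge0 u0 v'0) Bb Bb'.
  exists (s * t + (1 - s) * t'), a2, b2; split => //.
  + by rewrite addr_ge0// mulr_ge0.
  + by have := mulr_ge0 s0 v0; have := mulr_ge0 u0 v'0; lra.
  + rewrite -aE (_ : 1 - (s * t + (1 - s) * t') = s * (1 - t) + (1 - s) * (1 - t')); last by ring.
    by rewrite -bE !scalerDr !scalerA addrACA.
- move=> a Aa; exists 1, a, b0; split => //.
  by rewrite subrr scale1r scale0r addr0.
- move=> b Bb; exists 0, a0, b; split => //.
  by rewrite subr0 scale1r scale0r add0r.
Qed.

(** The zero function on [D] has an affine minorant with any prescribed value at [x], since points
    near [x] are outside the closed set [D]. *)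
Lemma affine_separation D x : compact D -> convex_set D -> ~ D x ->
  exists u : X -> R, [/\ affine u, continuous u, u x = 1 &
    forall y, D y -> u y <= 0].
Proof.
move=> Dc Dcvx Dx.
have [D0|/nonemptyPn D0] := pselect (D !=set0); last first.
  exists (fun=> 1); split => //; first exact: affine_cst.
    by move=> ?; exact: cvg_cst.
  by rewrite D0.
apply: (@affine_minorant _ _ D (fun=> 0) x 1 0) => //.
  by move=> *; rewrite !mulr0 addr0.
have : \forall y \near x, ~ D y.
  by apply: open_nbhs_nbhs; split => //; apply: closed_openC; exact: compact_closed.
by apply: filterS => y nDy /nDy.
Qed.

(* Otherwise the sets whose complement in [K `\` U] is contained in a compact
   convex subset of [K] avoiding [x] would form a proper filter on [K `\` U];
   it has no cluster point, since every [z != x] is separated from [x]. *)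
Lemma extreme_point_slice K U x : compact K -> convex_set K ->
  extreme_points K x -> open U -> U x ->
  exists u : X -> R, [/\ affine u, continuous u, u x = 1 &
    forall y, K y -> ~ U y -> u y <= 0].
Proof.
move=> Kc Kcvx [Kx Kext] Uo Ux.
pose Q D := [/\ compact D, convex_set D, D `<=` K & ~ D x].
have Qjoin A B : Q A -> Q B -> exists2 J, Q J & A `|` B `<=` J.
  move=> [Ac Acvx AK Ax] [Bc Bcvx BK Bx].
  have [A0|/nonemptyPn A0] := pselect (A !=set0); last first.
    by exists B => //; rewrite A0 set0U.
  have [B0|/nonemptyPn B0] := pselect (B !=set0); last first.
    by exists A => //; rewrite B0 setU0.
  have [Jc Jcvx AJ BJ] := convex_joinP Acvx Bcvx Ac Bc A0 B0.
  exists (convex_join A B); last by rewrite subUset.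
  split => // [z [t [a [b [t0 t1 Aa Bb ->]]]]|[t [a [b [t0 t1 Aa Bb xE]]]]].
    by have /convex_setP := Kcvx; apply => //; [exact: AK|exact: BK].
  (* If [x] were in the join, extremality would put it in [A] for [0 < t < 1]; the endpoints [t = 0]
     and [t = 1] put it in [B] and [A]. *)
  move: t0; rewrite le_eqVlt => /predU1P[t0|t0].
    by apply: Bx; move: xE; rewrite -t0 scale0r subr0 scale1r add0r => ->.
  move: t1; rewrite le_eqVlt => /predU1P[t1|t1].
    by apply: Ax; move: xE; rewrite t1 subrr scale0r scale1r addr0 => ->.
  by have [aE _] := Kext _ _ _ (AK _ Aa) (BK _ Bb) t0 t1 xE; apply: Ax; rewrite -aE.
have Q0 : Q set0.
  by split => //; exact: compact0.
have [[D [[Dc Dcvx DK Dx] KUD]]|nQ] := pselect (exists D, Q D /\ K `\` U `<=` D).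
  have [u [ua uc ux uD]] := affine_separation Dc Dcvx Dx.
  by exists u; split => // y Ky Uy; apply/uD/KUD.
exfalso.
pose F : set_system X := [set S | exists D, Q D /\ (K `\` U) `\` S `<=` D].
have FF : ProperFilter F.
  split; first by move=> [D [QD]]; rewrite setD0 => ?; apply: nQ; exists D.
  split.
  - by exists set0; split => // y [_] [].
  - move=> S T [A [QA SA]] [B [QB TB]]; have [J QJ ABJ] := Qjoin _ _ QA QB.
    exists J; split => // y [KUy nST]; apply: ABJ.
    have [Sy|nSy] := pselect (S y); last by left; apply: SA.
    by right; apply: TB; split => // Ty; apply: nST.
  - move=> S T ST [A [QA SA]]; exists A; split => // y [KUy nTy].
    by apply: SA; split => // /ST.
have KUc : compact (K `\` U).
  by rewrite setDE; apply: compact_closedI => //; exact: open_closedC.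
have [z [[Kz Uz] zF]] : (K `\` U) `&` cluster F !=set0.
  by apply: KUc; exists set0; split => //; rewrite setDv.
have [||//|u [ua uc ux uz]] := @affine_separation [set z] x.
- exact: compact_set1.
- apply/convex_setP => _ _ t -> -> _ _ /=.
  by rewrite -scalerDl addrC subrK scale1r.
- by move=> xz; apply: Uz; rewrite -xz.
(* The level lies between [u z <= 0] and [u x = 1]: [N] is a neighbourhood of [z], and its part in
   [K] is compact, convex and avoids [x], so the complement of [N] is in [F]. *)
pose N := [set y | u y <= 2^-1].
have Nz : nbhs z N.
  have : u z < 2^-1 by apply: le_lt_trans (uz z erefl) _; rewrite invr_gt0.
  move=> uz2; near=> y; apply/ltW; near: y.
  exact: (uc z _ (lt_nbhsl uz2)).
have FN : F (~` N).
  exists (K `&` N); split; last by move=> y [[Ky _]] /contrapT.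
  have Ncl : closed N by move/continuous_closedP: uc => /(_ _ (@closed_le R 2^-1)).
  split => //; first exact: compact_closedI.
  - apply/convex_setP => y w t [Ky Ny] [Kw Nw] t0 t1; split.
      by have /convex_setP := Kcvx; exact.
    rewrite /N/= ua; have u0 : 0 <= 1 - t by rewrite subr_ge0.
    have := ler_wpM2l t0 Ny; have := ler_wpM2l u0 Nw; lra.
  - by move=> [_]; rewrite /N/= ux => ?; lra.
by have [y []] := zF _ _ FN Nz.
Unshelve. all: by end_near. Qed.

End extreme.

(** * Bounded affine minorants of [f] and the refinement of a slice *)

Section variational.
Variables (R : realType) (X : tvsType R) (f : X -> R).
Hypotheses (f_lsc : lower_semicontinuous (EFin \o f))
  (f_sconvex : strictly_convex f) (f_bounded : bounded_on_compacts f).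
Implicit Types (K : set X) (u g : X -> R).

Lemma strictly_convex_le x y t : 0 <= t -> t <= 1 ->
  f (t *: x + (1 - t) *: y) <= t * f x + (1 - t) * f y.
Proof.
rewrite le_eqVlt => /predU1P[<- _|t0].
  by rewrite subr0 !scale0r !scale1r mul0r mul1r !add0r.
rewrite le_eqVlt => /predU1P[->|t1].
  by rewrite subrr !scale0r !scale1r mul0r mul1r !addr0.
have [->|/eqP xy] := eqVneq x y; last exact/ltW/f_sconvex.
by rewrite -scalerDl -mulrDl addrC subrK scale1r mul1r.
Qed.

(* A minorant of [f] on the compact set [2 K - K] that is nearly exact at a
   point [x0] of [K] is also bounded below on [K], because [2 x0 - y] is in
   [2 K - K] for [y] in [K]. *)
Lemma bounded_affine_minorant K : compact K -> convex_set K ->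
  exists2 L : R, 1 <= L & forall x0 e, K x0 -> 0 < e -> e <= 1 ->
  exists u, [/\ affine u, continuous u, u x0 = f x0 - e,
    forall y, K y -> u y <= f y & forall y, K y -> `|u y| <= L].
Proof.
move=> Kc /convex_setP Kcvx.
pose h (p : X * X) := 2 *: p.1 + (1 - 2) *: p.2.
pose C := h @` (K `*` K).
have Cc : compact C.
  apply: continuous_compact; last exact: compact_setX.
  apply: continuous_subspaceT => p.
  by apply: tvs_cvgD; apply: tvs_cvgZ;
    do ?[exact: cvg_cst|exact: cvg_fst|exact: cvg_snd].
have KC y : K y -> C y.
  move=> Ky; exists (y, y) => //.
  by rewrite /h/= -scalerDl addrC subrK scale1r.
have [m0 fm0] : exists m0 : R, forall y, C y -> `|f y| <= m0.
  by have [m0 ?] := @filter_ex _ (pinfty_nbhs R) _ _ (f_bounded Cc); exists m0.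
pose m := Num.max 0 m0.
have m_ge0 : 0 <= m by rewrite le_max lexx.
have fm y : C y -> `|f y| <= m by move=> Cy; rewrite le_max fm0 ?orbT.
have Ccvx x y t : C x -> C y -> 0 <= t -> t <= 1 -> C (t *: x + (1 - t) *: y).
  move=> [[p q] [/= Kp Kq] <-] [[p' q'] [/= Kp' Kq'] <-] t0 t1.
  exists (t *: p + (1 - t) *: p', t *: q + (1 - t) *: q').
    by split; exact: Kcvx.
  rewrite /h/= !scalerDr !scalerA addrACA.
  by rewrite ![2 * _]mulrC ![(1 - 2) * _]mulrC.
(* On [K], [u y <= m], and [2 * (f x0 - e) - u y <= m] with [e <= 1] gives [u y >= - 3 * m - 2]. *)
exists (3 * m + 3); first by lra.
move=> x0 e Kx0 e0 e1.
have [|||||u [ua uc ux0 uf]] := @affine_minorant _ _ C f x0 (f x0 - e) (- m).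
- by exists x0; exact: KC.
- exact/convex_setP.
- by move=> x y t _ _; exact: strictly_convex_le.
- by move=> y /fm; rewrite ler_norml => /andP[].
- have [|V Vx0 fV] := f_lsc (x := x0) (a := f x0 - e).
    by rewrite /= lte_fin; lra.
  by apply: filterS Vx0 => y /fV; rewrite /= lte_fin => /ltW.
exists u; split => // y Ky; first exact/uf/KC.
have := uf _ (KC _ Ky); have : u (h (x0, y)) <= f (h (x0, y)) by apply: uf; exists (x0, y).
rewrite /h/= ua ux0.
have : C (2 *: x0 + (1 - 2) *: y) by exists (x0, y).
move=> /fm; rewrite ler_norml => /andP[_ h1].
have /fm := KC _ Ky; rewrite ler_norml => /andP[_ h2].
have /fm := KC _ Kx0; rewrite ler_norml => /andP[h3 _] h4 h5.
by rewrite ler_norml; apply/andP; split; lra.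
Qed.

Lemma continuous_bounded K g : compact K -> continuous g ->
  exists m, forall y, K y -> `|g y| <= m.
Proof.
move=> Kc gc; have [->|/set0P K0] := eqVneq K set0; first by exists 0.
have ngc : continuous (fun y => `|g y|).
  by move=> y; apply: cvg_norm; exact: gc.
have [c _ cmax] := compact_EVT_max K0 Kc (continuous_subspaceT ngc).
by exists `|g c| => y Ky; exact/cmax/mem_set.
Qed.

(* [u] is a minorant of [f] nearly exact at a point where [g + h f] nearly
   attains its supremum on [K]. *)
Lemma slice_step K : compact K -> convex_set K -> K !=set0 ->
  exists2 L : R, 1 <= L & forall g h e, continuous g -> 0 < h -> 0 < e -> e <= 1 ->
  exists u (a : R) x, [/\ affine u, continuous u, forall y, K y -> `|u y| <= L,
    K x /\ a + h * e <= g x + h * u x &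
    forall y, K y -> a < g y + h * u y -> u y <= f y <= u y + 3 * e].
Proof.
move=> Kc Kcvx K0; have [L L1 minor] := bounded_affine_minorant Kc Kcvx.
exists L => // g h e gc h0 e0 e1.
have [m fm] : exists m : R, forall y, K y -> `|f y| <= m.
  by have [m ?] := @filter_ex _ (pinfty_nbhs R) _ _ (f_bounded Kc); exists m.
have [m' gm] := continuous_bounded Kc gc.
pose A := [set g y + h * f y | y in K].
have Asup : has_sup A.
  split; first exact: image_nonempty.
  exists (m' + h * m) => _ [y Ky <-]; apply: lerD.
    by apply: le_trans (gm _ Ky); exact: ler_norm.
  by rewrite ler_pM2l//; apply: le_trans (fm _ Ky); exact: ler_norm.
have he0 : 0 < h * e by exact: mulr_gt0.
have [_ [x Kx <-] xA] := sup_adherent he0 Asup.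
have [u [ua uc ux uf uL]] := minor x e Kx e0 e1.
exists u, (sup A - 3 * (h * e)), x; split => //.
  by split => //; rewrite ux; lra.
move=> y Ky ay; rewrite uf//=.
have : g y + h * f y <= sup A by apply: ub_le_sup; [case: Asup|exists y].
by move=> supA; rewrite -(ler_pM2l h0); lra.
Qed.

End variational.

(** * Uniform limits of affine functions; exposed points are extreme *)

Lemma affine_uniform_limit (R : realType) (X : tvsType R) (K : set X)
    (g : nat -> X -> R) (d : nat -> R) :
  convex_set K ->
  (forall n, affine (g n)) -> (forall n, continuous (g n)) ->
  (forall n, 0 < d n) -> (forall n, d n.+1 <= d n / 8) ->
  (forall e, 0 < e -> exists n, d n < e) ->
  (forall n y, K y -> `|g n.+1 y - g n y| <= d n / 8) ->
  exists w : X -> R, [/\ {within K, continuous w}, affine_on K w &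
    forall n y, K y -> `|w y - g n y| <= d n / 4].
Proof.
move=> /convex_setP Kcvx ga gc d0 d8 dlim gd.
have lo y : K y -> {homo (fun n => g n y - d n / 4) : n p / (n <= p)%N >-> n <= p}.
  move=> Ky; apply: homo_leq => [n //|p n q|n]; first exact: le_trans.
  have := gd n _ Ky; rewrite ler_norml => /andP[? _].
  by have := d8 n; have := d0 n; lra.
have hi y : K y -> {homo (fun n => - (g n y + d n / 4)) : n p / (n <= p)%N >-> n <= p}.
  move=> Ky; apply: homo_leq => [n //|p n q|n]; first exact: le_trans.
  have := gd n _ Ky; rewrite ler_norml => /andP[_ ?].
  by have := d8 n; have := d0 n; lra.
have lohi y n p : K y -> g n y - d n / 4 <= g p y + d p / 4.
  move=> Ky.
  have := lo _ Ky _ _ (leq_maxl n p); have := hi _ Ky _ _ (leq_maxr n p).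
  by have := d0 (maxn n p); lra.
(* For [y] in [K] the intervals of radius [d n / 4] around [g n y] are nested, because
   [d n / 8 + d n.+1 / 4 <= d n / 4]; [w y] is the supremum of their left ends. *)
pose w y := sup [set g n y - d n / 4 | n in [set: nat]].
have wg n y : K y -> `|w y - g n y| <= d n / 4.
  move=> Ky; rewrite ler_norml; apply/andP; split.
    suff : g n y - d n / 4 <= w y by lra.
    by apply: ub_le_sup; [exists (g 0%N y + d 0%N / 4) => _ [p _ <-]; exact: lohi|exists n].
  suff : w y <= g n y + d n / 4 by lra.
  by apply: ge_sup; [exists (g 0%N y - d 0%N / 4), 0%N|move=> _ [p _ <-]; exact: lohi].
exists w; split => //.
- apply/subspace_continuousP => x Kx; apply/cvgrPdist_le => e e0.
  have [n dn] := dlim _ e0.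
  have gx : \forall y \near x, `|g n x - g n y| <= e / 2.
    by have /cvgrPdist_le := gc n x; apply; rewrite divr_gt0.
  apply: filterS gx => y gxy Ky; rewrite /from_subspace.
  have := wg n _ Kx; have := wg n _ Ky.
  move: gxy; rewrite !ler_norml => /andP[? ?] /andP[? ?] /andP[? ?].
  by apply/andP; split; lra.
- move=> x y t Kx Ky t0 t1; apply/eqP; rewrite -subr_eq0 -normr_le0.
  apply/ler_addgt0Pl => e e0; rewrite addr0.
  have [n dn] := dlim _ e0.
  have u0 : 0 <= 1 - t by rewrite subr_ge0.
  have := wg n _ (Kcvx _ _ _ Kx Ky t0 t1); rewrite ga.
  have := wg n _ Kx; have := wg n _ Ky.
  rewrite !ler_norml => /andP[y1 y2] /andP[x1 x2] /andP[? ?].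
  have := ler_wpM2l t0 x1; have := ler_wpM2l t0 x2.
  have := ler_wpM2l u0 y1; have := ler_wpM2l u0 y2.
  by move=> *; apply/andP; split; lra.
Qed.

(** If a proper convex combination attains the maximum of [w], so do both of its endpoints. *)
Lemma exposed_points_extreme (R : realType) (X : tvsType R) (K : set X) :
  exposed_points K `<=` extreme_points K.
Proof.
move=> x [w [_ wa xE]].
have [Kx wx] : [set z | K z /\ (w z)%:E = ereal_sup [set (w y)%:E | y in K]] x.
  by rewrite -xE.
have wmax y : K y -> w y <= w x.
  by move=> Ky; rewrite -lee_fin wx; apply: ereal_sup_ubound; exists y.
have uniq y : K y -> w y = w x -> y = x.
  move=> Ky wyx; suff : [set x] y by [].
  by rewrite xE; split => //; rewrite wyx.
split => // y z t Ky Kz t0 t1 xyz.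
have := wa y z t Ky Kz (ltW t0) (ltW t1); rewrite -xyz => wE.
have t1' : 0 < 1 - t by rewrite subr_gt0.
have hy := wmax _ Ky; have hz := wmax _ Kz.
have hy' : t * w y <= t * w x by rewrite ler_pM2l.
have hz' : (1 - t) * w z <= (1 - t) * w x by rewrite ler_pM2l.
split; apply: uniq => //; apply/eqP; rewrite eq_le wmax//=.
  by rewrite -(ler_pM2l t0); lra.
by rewrite -(ler_pM2l t1'); lra.
Qed.

(** * Sequences of refined slices and their limit point *)

Section slices.
Variables (R : realType) (X : tvsType R) (f : X -> R).
Hypotheses (f_lsc : lower_semicontinuous (EFin \o f))
  (f_sconvex : strictly_convex f) (f_bounded : bounded_on_compacts f).

(* A slice [{g > a}] of [K] of depth at least [d]. *)
Definition slice_data (K : set X) (s : (X -> R) * R * R) : Prop :=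
  let: (g, a, d) := s in
  [/\ affine g, continuous g, 0 < d <= 1 & exists2 x, K x & a + d <= g x].

Definition slice_refines (K : set X) (s s' : (X -> R) * R * R) : Prop :=
  let: (g, a, d) := s in let: (g', a', d') := s' in
  [/\ d' <= d / 8, forall y, K y -> `|g' y - g y| <= d / 8 &
   exists u : X -> R, [/\ affine u, continuous u &
     forall y, K y -> a' < g' y -> u y <= f y <= u y + 3 * d]].

Lemma slice_sequence (K : set X) s0 : compact K -> convex_set K ->
  slice_data K s0 ->
  exists s : nat -> (X -> R) * R * R, [/\ s 0%N = s0,
    forall n, slice_data K (s n) & forall n, slice_refines K (s n) (s n.+1)].
Proof.
move=> Kc Kcvx s0K.
have K0 : K !=set0 by case: s0 s0K => [[g a] d] [_ _ _ [x Kx _]]; exists x.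
have [L L1 step] := slice_step f_lsc f_sconvex f_bounded Kc Kcvx K0.
have next (s : {s | slice_data K s}) : {s' : {s | slice_data K s} |
    slice_refines K (sval s) (sval s')}.
  apply: cid; case: s => [[[g a] d] /= sK].
  have [ga gc /andP[d0 d1] _] := sK.
  have L0 : 0 < L by lra.
  (* With [h = d / (8 * L)], the perturbation [h * u] is at most [d / 8] on [K], and the new depth
     [h * d] is at most [d / 8] because [d <= 1 <= L]. *)
  have h0 : 0 < d / (8 * L) by rewrite divr_gt0// mulr_gt0.
  have hL : d / (8 * L) * L = d / 8 by field; rewrite gt_eqF.
  have h1 : d / (8 * L) <= d / 8.
    by rewrite -hL ler_peMr// ltW.
  have [u [a' [x [ua uc uL [Kx xa'] uf]]]] := step g _ d gc h0 d0 d1.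
  have hd : d / (8 * L) * d <= d / 8 by apply: le_trans h1; rewrite ler_piMr// ltW.
  set h := d / (8 * L) in h0 hL h1 hd uf xa'.
  have sK' : slice_data K ((fun y => g y + h * u y), a', h * d).
    split.
    - by move=> y z t; rewrite ga ua; ring.
    - by move=> y; apply: cvgD; [exact: gc|apply: cvgM; [exact: cvg_cst|exact: uc]].
    - by rewrite mulr_gt0//=; lra.
    - by exists x.
  exists (exist _ _ sK') => /=; split => //.
  - move=> y Ky; rewrite addrC addKr normrM gtr0_norm// -hL.
    by rewrite ler_pM2l//; exact: uL.
  - by exists u.
have [s [s00 sR]] := dependent_choice next (exist _ s0 s0K).
exists (fun n => sval (s n)); split => [|n|n //]; first by rewrite s00.
exact: svalP.
Qed.

Lemma exposed_continuity_point_slice (K : set X) g a d :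
  compact K -> convex_set K -> slice_data K (g, a, d) ->
  exists x, [/\ exposed_points K x, continuity_points K f x & a < g x].
Proof.
move=> Kc Kcvx sK.
have [s [s0 sd sr]] := slice_sequence Kc Kcvx sK.
pose G n := (s n).1.1; pose A n := (s n).1.2; pose D n := (s n).2.
have sdE n : slice_data K (G n, A n, D n).
  by have := sd n; rewrite /G /A /D; case: (s n) => [[]].
have srE n : slice_refines K (G n, A n, D n) (G n.+1, A n.+1, D n.+1).
  by have := sr n; rewrite /G /A /D; case: (s n) => [[? ?] ?]; case: (s n.+1) => [[]].
have D0 n : 0 < D n by have [_ _ /andP[]] := sdE n.
have D8 n : D n.+1 <= D n / 8 by have [] := srE n.
have DS n : D n <= n.+1%:R^-1.
  elim: n => [|n IH]; first by have [_ _ /andP[_]] := sdE 0%N; rewrite invr1.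
  apply: le_trans (D8 n) _; apply: (@le_trans _ _ (n.+1%:R^-1 / 8)); first by rewrite ler_pM2r// invr_gt0.
  rewrite -invfM lef_pV2 ?posrE ?mulr_gt0// -natrM ler_nat.
  by rewrite -addn1 mulnS leq_add2l muln_gt0.
have Dlim e : 0 < e -> exists n, D n < e.
  move=> e0; have [n ne] := filter_ex (near_infty_natSinv_lt (PosNum e0)).
  by exists n; exact: le_lt_trans (DS n) ne.
have Ga n : affine (G n) by have [] := sdE n.
have Gc n : continuous (G n) by have [] := sdE n.
have GD n y : K y -> `|G n.+1 y - G n y| <= D n / 8 by have [_ + _] := srE n; exact.
have [w [wc wa wG]] := affine_uniform_limit Kcvx Ga Gc D0 D8 Dlim GD.
have K0 : K !=set0 by have [_ _ _ [x Kx _]] := sK; exists x.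
have [x /set_mem Kx xmax] := compact_EVT_max K0 Kc wc.
have wmax y : K y -> w y <= w x by move=> Ky; exact/xmax/mem_set.
(* Some [z] in [K] has [G n z >= A n + D n]. Since [w] is within [D n / 4] of [G n] on [K], a
   maximizer [y] of [w] has [G n y >= A n + D n / 2]. *)
have inslice n y : K y -> w y = w x -> A n < G n y.
  move=> Ky wyx; have [_ _ _ [z Kz zA]] := sdE n.
  have := wG n _ Ky; have := wG n _ Kz; rewrite !ler_norml => /andP[? ?] /andP[? ?].
  by have := wmax _ Kz; have := D0 n; lra.
have half0 : 0 <= 2^-1 :> R by rewrite invr_ge0.
have half1 : 2^-1 <= 1 :> R by lra.
have wuniq y : K y -> w y = w x -> y = x.
  move=> Ky wyx; apply: contrapT => yx.
  pose z := 2^-1 *: y + (1 - 2^-1) *: x.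
  have Kz : K z by have /convex_setP := Kcvx; exact.
  have wz : w z = w x by rewrite wa// wyx; lra.
  have fz : 0 < f y / 2 + f x / 2 - f z.
    have := @f_sconvex y x 2^-1 yx; rewrite invr_gt0 ltr0n => /(_ isT).
    rewrite -/z => h; have {}h := h ltac:(lra); lra.
  (* All three points are in slice [n.+1], where [u <= f <= u + 3 * D n] with [u] affine; so the
     midpoint gap of [f] is at most [3 * D n]. *)
  have [n Dn] := Dlim _ (divr_gt0 fz (ltr0n R 3)).
  have [_ _ [u [ua _ uf]]] := srE n.
  have /andP[y1 y2] := uf _ Ky (inslice n.+1 _ Ky wyx).
  have /andP[x1 x2] := uf _ Kx (inslice n.+1 _ Kx erefl).
  have /andP[z1 z2] := uf _ Kz (inslice n.+1 _ Kz wz).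
  have uz : u z = 2^-1 * u y + (1 - 2^-1) * u x by exact: ua.
  by suff : D n < D n; [rewrite ltxx|lra].
exists x; split.
- exists w; split => //.
  have sup_w : ereal_sup [set (w y)%:E | y in K] = (w x)%:E.
    apply/eqP; rewrite eq_le; apply/andP; split.
      by apply: ge_ereal_sup => _ [y Ky <-]; rewrite lee_fin wmax.
    by apply: ereal_sup_ubound; exists x.
  apply/seteqP; split => [_ ->|y [Ky]]; first by split.
  by rewrite sup_w => -[/wuniq]; exact.
- split => //; apply/cvgrPdist_le => e e0.
  (* Near [x] in [K], [f] varies from [f x] by at most [e / 7 + 3 * D n], which is less than [e]. *)
  have [n Dn] := Dlim _ (divr_gt0 e0 (ltr0n R 7)).
  have [_ _ [u [_ uc uf]]] := srE n.
  have ux : \forall y \near x, `|u x - u y| <= e / 7.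
    by have /cvgrPdist_le := uc x; apply; rewrite divr_gt0.
  have Gx : \forall y \near x, A n.+1 < G n.+1 y.
    exact: (Gc n.+1 x _ (lt_nbhsr (inslice n.+1 _ Kx erefl))).
  apply: filterS2 ux Gx => y uxy Gy Ky.
  have /andP[y1 y2] := uf _ Ky Gy.
  have /andP[x1 x2] := uf _ Kx (inslice n.+1 _ Kx erefl).
  move: uxy; rewrite !ler_norml => /andP[? ?]; apply/andP; split; lra.
- by have := inslice 0%N _ Kx erefl; rewrite /A /G s0.
Qed.

End slices.

Theorem theorem1p2 (R : realType) (X : tvsType R) (f : X -> R)
    (hX : hausdorff_space X)
    (f_lsc : lower_semicontinuous (EFin \o f))
    (f_sconvex : strictly_convex f)
    (f_bounded : bounded_on_compacts f)
    (K : set X) (K_compact : compact K) (K_convex : convex_set K) :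
  dense_in (exposed_points K `&` continuity_points K f) (extreme_points K).
Proof.
split=> [x [xexp _]|x xext B]; first exact: exposed_points_extreme.
rewrite nbhsE => -[U [Uo Ux] UB].
have [u [ua uc ux uU]] := extreme_point_slice hX K_compact K_convex xext Uo Ux.
(* As [u x = 1] and [u <= 0] on [K] outside [U], the slice [u > 2^-1] has depth [2^-1] at [x] and
   lies in [U]. *)
have [|y [yexp ycont ay]] := exposed_continuity_point_slice f_lsc f_sconvex
  f_bounded (g := u) (a := 2^-1) (d := 2^-1) K_compact K_convex.
  split => //; first by rewrite invr_gt0 ltr0n/=; lra.
  by exists x; [case: xext|rewrite ux; lra].
exists y; split => //; apply: UB; apply: contrapT => Uy.
have [Ky _] := ycont.
by have := uU _ Ky Uy; lra.
Qed.
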